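(* Let $R$ be a ring and let $(a_i)_{i\in I}$ and $(b_j)_{j\in J}$ be finite collections of elements of $R$. In the universal valuation semiring $\Gamma_R$ we have $$\left[\sum_{i\in I} x_{a_i}\right]=\left[\sum_{j\in J} x_{b_j}\right]$$ if and only if $\operatorname{Span}_{\mathbb{Z}}(a_i : i\in I)=\operatorname{Span}_{\mathbb{Z}}(b_j : j \in J)$.
   Context: Rings and semirings are unital and not necessarily commutative. A semiring $(S,+,*,0_S,1_S)$ has $(S,+,0_S)$ a commutative monoid, $(S,*,1_S)$ a monoid, multiplication distributing over addition on both sides, and $0_S$ annihilating multiplicatively. A semiring is idempotent if $a+a=a$ for all $a$. Let $\mathbb{B}$ be the boolean semiring $\{0,1\}$ with $1+1=1$. For a ring $R$, take a variable $x_a$ for each $a\in R$, and let $\mathbb{B}\langle x_R\rangle$ be the non-commutative polynomial semiring over $\mathbb{B}$ in these variables (elements are finite sums, with idempotent addition, of words in the variables; multiplication is concatenation extended distributively). A congruence on a semiring $S$ is an equivalence relation that is a subsemiring of $S\times S$. The universal valuation semiring is $\Gamma_R=\mathbb{B}\langle x_R\rangle/\sim$, where $\sim$ is the smallest congruence containing the relations, for all $a,b\in R$: $x_0\sim 0$, $x_1\sim 1$, $x_{-1}\sim 1$, $x_ax_b\sim x_{ab}$, $x_{a+b}+x_a+x_b\sim x_a+x_b$. The class of an element $y$ is written $[y]$. $\operatorname{Span}_{\mathbb{Z}}(A)$ denotes the additive subgroup of $R$ generated by $A\subseteq R$, with $\operatorname{Span}_{\mathbb{Z}}(\emptyset)=\{0\}$.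 *)

(* Defs.v *)
(* MathComp, with the classical layer of MathComp-Analysis and finmap. *)
From HB Require Import structures.
From mathcomp Require Import all_boot all_order all_algebra finmap.
From mathcomp Require Import boolp classical_sets.

Set Implicit Arguments.
Unset Strict Implicit.
Unset Printing Implicit Defensive.

Import GRing.Theory.
Local Open Scope classical_set_scope.
Local Open Scope fset_scope.
Local Open Scope ring_scope.
Local Open Scope quotient_scope.

(* The non-commutative polynomial semiring over the boolean semiring: as the
   coefficients are 0 or 1 with 1 + 1 = 1, a polynomial is the finite set of
   the words that occur in it, and addition is union. *)
Definition bpoly (X : choiceType) := {fset seq X}.

HB.instance Definition _ (X : choiceType) := Choice.on (bpoly X).

Section BooleanPolynomials.
Variable X : choiceType.
Implicit Types p q r : bpoly X.

Definition bpoly_mul p q : bpoly X := [fset u ++ v | u in p, v in q].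
Definition bpoly_var (x : X) : bpoly X := [fset [:: x]].

Lemma bpoly_mulP w p q :
  reflect (exists u v, [/\ u \in p, v \in q & w = u ++ v])
          (w \in bpoly_mul p q).
Proof.
apply: (iffP idP) => [/imfset2P[u up [v vq ->]]|[u [v [up vq ->]]]].
  by exists u, v.
by apply/imfset2P; exists u => //; exists v.
Qed.

Lemma bpoly_mulA : associative bpoly_mul.
Proof.
move=> p q r; apply/fsetP => w; apply/bpoly_mulP/bpoly_mulP.
  move=> [u [_ [up /bpoly_mulP[v [t [vq tr ->]]] ->]]].
  exists (u ++ v), t; split; rewrite ?catA //.
  by apply/bpoly_mulP; exists u, v.
move=> [_ [t [/bpoly_mulP[u [v [up vq ->]]] tr ->]]].
exists u, (v ++ t); split; rewrite ?catA //.
by apply/bpoly_mulP; exists v, t.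
Qed.

Lemma bpoly_mul1l : left_id ([fset [::]] : bpoly X) bpoly_mul.
Proof.
move=> p; apply/fsetP => w; apply/bpoly_mulP/idP.
  by move=> [u [v [/fset1P -> vp ->]]].
by move=> wp; exists [::], w; rewrite fset11.
Qed.

Lemma bpoly_mul1r : right_id ([fset [::]] : bpoly X) bpoly_mul.
Proof.
move=> p; apply/fsetP => w; apply/bpoly_mulP/idP.
  by move=> [u [v [up /fset1P -> ->]]]; rewrite cats0.
by move=> wp; exists w, [::]; rewrite fset11 cats0.
Qed.

Lemma bpoly_mulDl : left_distributive bpoly_mul (@fsetU (seq X)).
Proof.
move=> p q r; apply/fsetP => w; rewrite inE; apply/bpoly_mulP/orP.
  move=> [u [v [/fsetUP[up|uq] vr ->]]]; [left|right];
  by apply/bpoly_mulP; exists u, v.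
by move=> [] /bpoly_mulP[u [v [uP vr ->]]]; exists u, v; rewrite inE uP ?orbT.
Qed.

Lemma bpoly_mulDr : right_distributive bpoly_mul (@fsetU (seq X)).
Proof.
move=> p q r; apply/fsetP => w; rewrite inE; apply/bpoly_mulP/orP.
  move=> [u [v [up /fsetUP[vq|vr] ->]]]; [left|right];
  by apply/bpoly_mulP; exists u, v.
by move=> [] /bpoly_mulP[u [v [up vP ->]]]; exists u, v; rewrite inE vP ?orbT.
Qed.

Lemma bpoly_mul0l : left_zero (fset0 : bpoly X) bpoly_mul.
Proof.
move=> p; apply/fsetP => w; rewrite inE; apply/negbTE/bpoly_mulP.
by move=> [u [v []]]; rewrite inE.
Qed.

Lemma bpoly_mul0r : right_zero (fset0 : bpoly X) bpoly_mul.
Proof.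
move=> p; apply/fsetP => w; rewrite inE; apply/negbTE/bpoly_mulP.
by move=> [u [v []]]; rewrite inE.
Qed.

Lemma bpoly_one_neq0 : ([fset [::]] : bpoly X) != fset0.
Proof. by apply/fset0Pn; exists [::]; rewrite fset11. Qed.

HB.instance Definition _ := GRing.isNzSemiRing.Build (bpoly X)
  (@fsetUA (seq X)) (@fsetUC (seq X)) (@fset0U (seq X))
  bpoly_mulA bpoly_mul1l bpoly_mul1r bpoly_mulDl bpoly_mulDr
  bpoly_mul0l bpoly_mul0r bpoly_one_neq0.

End BooleanPolynomials.

Section Congruences.
Variable S : pzSemiRingType.

Definition congruence (E : set (S * S)) : Prop :=
  equivalence_rel (fun x y => (x, y) \in E) /\
  semiring_closed [pred p | p \in E].

Definition generated_congruence (r : S -> S -> Prop) : set (S * S) :=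
  smallest congruence [set p | r p.1 p.2].

Variable r : S -> S -> Prop.

Definition congr_rel : rel S := fun x y => (x, y) \in generated_congruence r.

Lemma generated_congruenceP (p : S * S) :
  reflect (forall E, congruence E -> (forall x y, r x y -> (x, y) \in E) ->
             p \in E)
          (p \in generated_congruence r).
Proof.
apply: (iffP idP) => [/set_mem pG E cE rE|pG].
  by apply/mem_set/(pG E); split=> // -[x y] /= /rE /set_mem.
apply/mem_set => E [cE rE]; apply/set_mem/(pG E cE) => x y rxy.
by apply/mem_set/rE.
Qed.

Lemma congruence_generated : congruence (generated_congruence r).
Proof.
split.
  move=> x y z; split.
    by apply/generated_congruenceP => E [eqE _] _; exact: (eqE z z z).1.
  move=> /generated_congruenceP xy.
  apply/generated_congruenceP/generated_congruenceP => h E cE rE;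
    have := (cE.1 x y z).2 (xy E cE rE); have := h E cE rE.
    by move=> -> <-.
  by move=> -> ->.
split; split.
- by apply/generated_congruenceP => E [_ [[E0 _] _]] _.
- move=> u v /generated_congruenceP uG /generated_congruenceP vG.
  apply/generated_congruenceP => E cE rE.
  by have [_ [[_ ED] _]] := cE; apply: ED; [exact: uG|exact: vG].
- by apply/generated_congruenceP => E [_ [_ [E1 _]]] _.
- move=> u v /generated_congruenceP uG /generated_congruenceP vG.
  apply/generated_congruenceP => E cE rE.
  by have [_ [_ [_ EM]]] := cE; apply: EM; [exact: uG|exact: vG].
Qed.

Lemma congr_rel_equiv : equiv_class_of congr_rel.
Proof.
have [eqG _] := congruence_generated.
have xx x : congr_rel x x := (eqG x x x).1.
split=> //.
  move=> x y; apply/idP/idP => h.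
    by have := (eqG x y x).2 h; rewrite /congr_rel => <-; exact: xx.
  by have := (eqG y x y).2 h; rewrite /congr_rel => <-; exact: xx.
by move=> y x z xy yz; have := (eqG x y z).2 xy; rewrite /congr_rel => ->.
Qed.

Canonical congr_equiv := EquivRelPack congr_rel_equiv.

Definition congr_quot := {eq_quot congr_equiv}.

HB.instance Definition _ := Choice.on congr_quot.
HB.instance Definition _ := EqQuotient.on congr_quot.

Lemma congr_piP (x y : S) :
  reflect (\pi_congr_quot x = \pi_congr_quot y) (congr_rel x y).
Proof. exact: (@eqmodP _ congr_equiv x y). Qed.

Definition quot_zero : congr_quot := lift_cst congr_quot 0.
Definition quot_one : congr_quot := lift_cst congr_quot 1.
Definition quot_add : congr_quot -> congr_quot -> congr_quot :=
  lift_op2 congr_quot +%R.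
Definition quot_mul : congr_quot -> congr_quot -> congr_quot :=
  lift_op2 congr_quot *%R.

Lemma congr_relD x x' y y' :
  congr_rel x x' -> congr_rel y y' -> congr_rel (x + y) (x' + y').
Proof.
have [_ [[_ GD] _]] := congruence_generated.
by move=> xx' yy'; exact: (GD (x, x') (y, y')).
Qed.

Lemma congr_relM x x' y y' :
  congr_rel x x' -> congr_rel y y' -> congr_rel (x * y) (x' * y').
Proof.
have [_ [_ [_ GM]]] := congruence_generated.
by move=> xx' yy'; exact: (GM (x, x') (y, y')).
Qed.

Lemma congr_repr x : congr_rel (repr (\pi_congr_quot x)) x.
Proof. by apply/congr_piP; rewrite reprK. Qed.

Lemma pi_quot_add : {morph \pi_congr_quot : x y / x + y >-> quot_add x y}.
Proof.
move=> x y; rewrite /quot_add; unlock; apply/esym/congr_piP.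
by apply: congr_relD; exact: congr_repr.
Qed.
Canonical pi_quot_add_morph := PiMorph2 pi_quot_add.

Lemma pi_quot_mul : {morph \pi_congr_quot : x y / x * y >-> quot_mul x y}.
Proof.
move=> x y; rewrite /quot_mul; unlock; apply/esym/congr_piP.
by apply: congr_relM; exact: congr_repr.
Qed.
Canonical pi_quot_mul_morph := PiMorph2 pi_quot_mul.

Canonical pi_quot_zero_morph := PiConst quot_zero.
Canonical pi_quot_one_morph := PiConst quot_one.

Lemma quot_addA : associative quot_add.
Proof.
by elim/quotW=> x; elim/quotW=> y; elim/quotW=> z; rewrite !piE addrA.
Qed.
Lemma quot_addC : commutative quot_add.
Proof. by elim/quotW=> x; elim/quotW=> y; rewrite !piE addrC. Qed.
Lemma quot_add0 : left_id quot_zero quot_add.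
Proof. by elim/quotW=> x; rewrite !piE add0r. Qed.
Lemma quot_mulA : associative quot_mul.
Proof.
by elim/quotW=> x; elim/quotW=> y; elim/quotW=> z; rewrite !piE mulrA.
Qed.
Lemma quot_mul1l : left_id quot_one quot_mul.
Proof. by elim/quotW=> x; rewrite !piE mul1r. Qed.
Lemma quot_mul1r : right_id quot_one quot_mul.
Proof. by elim/quotW=> x; rewrite !piE mulr1. Qed.
Lemma quot_mulDl : left_distributive quot_mul quot_add.
Proof.
by elim/quotW=> x; elim/quotW=> y; elim/quotW=> z; rewrite !piE mulrDl.
Qed.
Lemma quot_mulDr : right_distributive quot_mul quot_add.
Proof.
by elim/quotW=> x; elim/quotW=> y; elim/quotW=> z; rewrite !piE mulrDr.
Qed.
Lemma quot_mul0l : left_zero quot_zero quot_mul.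
Proof. by elim/quotW=> x; rewrite !piE mul0r. Qed.
Lemma quot_mul0r : right_zero quot_zero quot_mul.
Proof. by elim/quotW=> x; rewrite !piE mulr0. Qed.

HB.instance Definition _ := GRing.isPzSemiRing.Build congr_quot
  quot_addA quot_addC quot_add0 quot_mulA quot_mul1l quot_mul1r
  quot_mulDl quot_mulDr quot_mul0l quot_mul0r.

End Congruences.

(* [pzRingType] rather than [nzRingType]: the zero ring is allowed. *)
Section UniversalValuation.
Variable R : pzRingType.

Local Notation x_ := (@bpoly_var R).

Inductive valuation_relation : bpoly R -> bpoly R -> Prop :=
  | valrel0 : valuation_relation (x_ 0) 0
  | valrel1 : valuation_relation (x_ 1) 1
  | valrelN1 : valuation_relation (x_ (- 1)) 1
  | valrelM (a b : R) : valuation_relation (x_ a * x_ b) (x_ (a * b))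
  | valrelD (a b : R) :
      valuation_relation (x_ (a + b) + x_ a + x_ b) (x_ a + x_ b).

Definition universal_valuation_semiring := congr_quot valuation_relation.

HB.instance Definition _ := EqQuotient.on universal_valuation_semiring.
HB.instance Definition _ := GRing.PzSemiRing.on universal_valuation_semiring.

End UniversalValuation.

Definition Zspan (V : zmodType) (A : set V) : set V :=
  smallest (fun G : set V => zmod_closed [pred x | x \in G]) A.

(* Main.v *)
(* A polynomial p has a value A_p, the set of the values in R of its words.
   "A_p and A_q span the same additive subgroup" is a congruence containing the
   defining relations, which gives one implication. Conversely, if s is the class
   of the sum of the x_{a_i}, the c with [x_c] + s = s form an additive subgroup
   containing every a_i, so it contains every b_j when the spans agree: thus
   the two classes absorb each other and are equal. *)
Require Import Defs.
From mathcomp Require Import all_boot all_order all_algebra finmap.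
From mathcomp Require Import boolp classical_sets.

Local Open Scope classical_set_scope.
Local Open Scope ring_scope.
Local Open Scope quotient_scope.

Import GRing.Theory.

(** * Additive subgroups generated by a set *)

Section Spans.
Variable V : zmodType.
Implicit Types A B G : set V.

Lemma Zspan_closed A : zmod_closed [pred x | x \in Zspan A].
Proof.
split; first by apply/mem_set => G [[G0 _] _]; exact/set_mem.
move=> u v /set_mem uA /set_mem vA; apply/mem_set => G [cG AG].
by apply/set_mem/cG.2; apply/mem_set; [exact: uA|exact: vA].
Qed.

Lemma sub_Zspan A : A `<=` Zspan A.
Proof. exact: sub_gen_smallest. Qed.

Lemma Zspan_min A G :
  zmod_closed [pred x | x \in G] -> A `<=` G -> Zspan A `<=` G.
Proof. by move=> cG AG; exact: smallest_sub. Qed.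

Lemma Zspan_subset A B : A `<=` Zspan B -> Zspan A `<=` Zspan B.
Proof. by move=> AB; apply: Zspan_min => //; exact: Zspan_closed. Qed.

(** The preimage of [Zspan B] under [f] is an additive subgroup, so checking the generators is
    enough. *)
Lemma Zspan_additive (f : {additive V -> V}) A B :
  (forall x, A x -> Zspan B (f x)) -> forall x, Zspan A x -> Zspan B (f x).
Proof.
move=> AB; change (Zspan A `<=` f @^-1` Zspan B).
apply: Zspan_min => //; have [c0 cB] := Zspan_closed B.
split; first by apply/mem_set; rewrite /preimage /= raddf0; exact/set_mem.
move=> u v /set_mem uB /set_mem vB; apply/mem_set.
rewrite /preimage /= raddfB; apply/set_mem.
by apply: cB; exact/mem_set.
Qed.

Lemma ZspanU A A' B B' : Zspan A = Zspan A' -> Zspan B = Zspan B' ->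
  Zspan (A `|` B) = Zspan (A' `|` B').
Proof.
have sub (C C' D D' : set V) : Zspan C = Zspan C' -> Zspan D = Zspan D' ->
    Zspan (C `|` D) `<=` Zspan (C' `|` D').
  move=> eC eD; apply: Zspan_subset; rewrite subUset; split.
    apply: subset_trans (@sub_Zspan C) _; rewrite eC.
    by apply: Zspan_subset => x ?; apply: sub_Zspan; left.
  apply: subset_trans (@sub_Zspan D) _; rewrite eD.
  by apply: Zspan_subset => x ?; apply: sub_Zspan; right.
by move=> eA eB; apply/seteqP; split; apply: sub.
Qed.

(** Serves the relation [valrel0]: the word [x_0] has the value 0, while the zero polynomial has no
    value at all. *)
Lemma Zspan0 : Zspan [set (0 : V)] = Zspan set0.
Proof.
apply/seteqP; split; apply: Zspan_subset => // _ ->.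
exact/set_mem/(Zspan_closed _).1.
Qed.

End Spans.

(** Multiplication is additive in each argument, so generators can be exchanged one factor at a
    time. *)
Lemma ZspanM (R : pzRingType) (A A' B B' : set R) :
  Zspan A = Zspan A' -> Zspan B = Zspan B' ->
  Zspan [set x * y | x in A & y in B] = Zspan [set x * y | x in A' & y in B'].
Proof.
have sub (C C' D D' : set R) : Zspan C = Zspan C' -> Zspan D = Zspan D' ->
    Zspan [set x * y | x in C & y in D] `<=`
    Zspan [set x * y | x in C' & y in D'].
  move=> eC eD; apply: Zspan_subset => _ [x Cx [y Dy <-]].
  have: Zspan D' y by rewrite -eD; exact: sub_Zspan.
  (* Left multiplication by [x] reduces to [y] in [D']; right multiplication by that [y] then
     reduces to [x] in [C']. *)
  apply: (Zspan_additive _ (x \*o idfun) D') => {y Dy} y Dy.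
  have: Zspan C' x by rewrite -eC; exact: sub_Zspan.
  apply: (Zspan_additive _ (y \o* idfun) C') => {x Cx} x Cx.
  by apply: sub_Zspan; exists x => //; exists y.
by move=> eA eB; apply/seteqP; split; apply: sub.
Qed.

(** * Values of polynomials: equal classes have equal spans *)

Section Evaluation.
Variable R : pzRingType.
Implicit Types p q : bpoly R.

Definition bpoly_values p : set R := [set \prod_(z <- w) z | w in [set` p]].

Lemma bpoly_values0 : bpoly_values 0 = set0.
Proof. by apply/seteqP; split => // x [w]; rewrite /= in_fset0. Qed.

Lemma bpoly_values_word (w : seq R) :
  bpoly_values [fset w]%fset = [set \prod_(z <- w) z].
Proof.
apply/seteqP; split => [_ [v /fset1P -> <-] //|_ ->].
by exists w => //=; rewrite fset11.
Qed.

Lemma bpoly_values_var (c : R) : bpoly_values (bpoly_var c) = [set c].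
Proof. by rewrite bpoly_values_word big_seq1. Qed.

Lemma bpoly_values1 : bpoly_values 1 = [set 1].
Proof. by rewrite bpoly_values_word big_nil. Qed.

Lemma bpoly_valuesD p q :
  bpoly_values (p + q) = bpoly_values p `|` bpoly_values q.
Proof.
apply/seteqP; split => [_ [w /fsetUP[wp|wq] <-]|_ [[w wp <-]|[w wq <-]]].
- by left; exists w.
- by right; exists w.
- by exists w => //; apply/fsetUP; left.
- by exists w => //; apply/fsetUP; right.
Qed.

Lemma bpoly_valuesM p q :
  bpoly_values (p * q) = [set x * y | x in bpoly_values p & y in bpoly_values q].
Proof.
apply/seteqP; split.
  move=> _ [w /bpoly_mulP[u [v [up vq ->]]] <-]; rewrite big_cat /=.
  exists (\prod_(z <- u) z); first by exists u.
  by exists (\prod_(z <- v) z) => //; exists v.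
move=> _ [_ [u up <-] [_ [v vq <-] <-]].
by exists (u ++ v); rewrite ?big_cat //; apply/bpoly_mulP; exists u, v.
Qed.

Lemma bpoly_values_sum_var (I : finType) (a : I -> R) :
  bpoly_values (\sum_(i : I) bpoly_var (a i)) = range a.
Proof.
rewrite (big_morph bpoly_values bpoly_valuesD bpoly_values0).
apply/seteqP; split => [x|_ [i _ <-]].
  apply: (big_ind (fun A : set R => A x -> range a x)) => //.
    by move=> A B hA hB [/hA|/hB].
  by move=> i _; rewrite bpoly_values_var => ->; exists i.
by rewrite (bigD1 i) //= bpoly_values_var; left.
Qed.

(** The kernel of the evaluation of polynomials in the idempotent semiring of additive subgroups of
    [R], where [x_c] goes to the subgroup generated by [c]. *)
Definition same_Zspan : set (bpoly R * bpoly R) :=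
  [set pq | Zspan (bpoly_values pq.1) = Zspan (bpoly_values pq.2)].

Lemma congruence_same_Zspan : congruence same_Zspan.
Proof.
split.
  move=> p q r; split; first exact/mem_set.
  move=> /set_mem pq.
  apply/idP/idP => /set_mem pr; apply/mem_set.
    exact: etrans (esym pq) pr.
  exact: etrans pq pr.
split; split; first exact/mem_set.
- move=> [p p'] [q q'] /set_mem /= hp /set_mem /= hq; apply/mem_set => /=.
  by rewrite /same_Zspan /= !bpoly_valuesD; exact: ZspanU.
- exact/mem_set.
- move=> [p p'] [q q'] /set_mem /= hp /set_mem /= hq; apply/mem_set => /=.
  by rewrite /same_Zspan /= !bpoly_valuesM; exact: ZspanM.
Qed.

Lemma same_Zspan_relation p q :
  valuation_relation p q -> (p, q) \in same_Zspan.
Proof.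
move=> pq; apply/mem_set; rewrite /same_Zspan /=; case: pq => [||| a b | a b].
- by rewrite bpoly_values_var bpoly_values0 Zspan0.
- by rewrite bpoly_values_var bpoly_values1.
- rewrite bpoly_values_var bpoly_values1.
  (* Taken at 1 and at -1, this gives both inclusions. *)
  have sub (x : R) : Zspan [set - x] `<=` Zspan [set x].
    apply: Zspan_subset => _ ->; rewrite -sub0r.
    have [c0 cB] := Zspan_closed R [set x].
    by apply/set_mem; apply: cB => //; apply/mem_set; exact: sub_Zspan.
  by apply/seteqP; split => //; have := sub (- 1); rewrite opprK.
- rewrite bpoly_valuesM !bpoly_values_var; congr Zspan.
  apply/seteqP; split => [_ [_ -> [_ -> <-]] //|_ ->].
  by exists a => //; exists b.
- rewrite !bpoly_valuesD !bpoly_values_var; apply/seteqP.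
  split; apply: Zspan_subset; last first.
    by move=> x [->|->]; apply: sub_Zspan; [left; right|right].
  have [c0 cB] := Zspan_closed R ([set a] `|` [set b]).
  have sa : a \in Zspan ([set a] `|` [set b]).
    by apply/mem_set; apply: sub_Zspan; left.
  have sb : b \in Zspan ([set a] `|` [set b]).
    by apply/mem_set; apply: sub_Zspan; right.
  move=> _ [[->|->]|->]; apply/set_mem => //.
  (* Closure is stated for differences, so [a + b] is reached as [a - (0 - b)]. *)
  by have := cB _ _ sa (cB _ _ c0 sb); rewrite sub0r opprK.
Qed.

Lemma pi_same_Zspan p q :
  \pi_(universal_valuation_semiring R) p =
  \pi_(universal_valuation_semiring R) q ->
  Zspan (bpoly_values p) = Zspan (bpoly_values q).
Proof.
move=> /congr_piP/generated_congruenceP h.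
exact/set_mem/(h _ congruence_same_Zspan same_Zspan_relation).
Qed.

End Evaluation.

(** * Absorption in the universal valuation semiring: equal spans give equal classes *)

Section Valuation.
Variable R : pzRingType.
Local Notation Gamma := (universal_valuation_semiring R).

Definition valuation (c : R) : Gamma := \pi_Gamma (bpoly_var c).

Lemma pi_relation (p q : bpoly R) :
  valuation_relation p q -> \pi_Gamma p = \pi_Gamma q.
Proof.
move=> pq; apply/congr_piP/generated_congruenceP => E _; exact.
Qed.

Lemma pi_Gamma0 : \pi_Gamma 0 = 0 :> Gamma.
Proof. by rewrite [RHS]/GRing.zero /= /quot_zero; unlock. Qed.

Lemma pi_Gamma1 : \pi_Gamma 1 = 1 :> Gamma.
Proof. by rewrite [RHS]/GRing.one /= /quot_one; unlock. Qed.

Lemma pi_GammaD p q : \pi_Gamma (p + q) = \pi_Gamma p + \pi_Gamma q :> Gamma.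
Proof. exact: pi_quot_add. Qed.

Lemma pi_GammaM p q : \pi_Gamma (p * q) = \pi_Gamma p * \pi_Gamma q :> Gamma.
Proof. exact: pi_quot_mul. Qed.

Lemma Gamma_addxx (x : Gamma) : x + x = x.
Proof.
elim/quotW: x => p; rewrite -pi_GammaD; congr (\pi_Gamma _); exact: fsetUid.
Qed.

Lemma valuation0 : valuation 0 = 0.
Proof. by rewrite -pi_Gamma0; apply: pi_relation; constructor. Qed.

(** Write [- c] as [-1 * c]: multiplicativity splits off the class of [x_{-1}], which is 1. *)
Lemma valuationN c : valuation (- c) = valuation c.
Proof.
rewrite -mulN1r -[RHS]mul1r -pi_Gamma1 -(pi_relation _ _ (@valrelN1 R)).
by rewrite -pi_GammaM; apply/esym/pi_relation; constructor.
Qed.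

Lemma valuationD c d :
  valuation (c + d) + valuation c + valuation d = valuation c + valuation d.
Proof. by rewrite -!pi_GammaD; apply: pi_relation; constructor. Qed.

Lemma absorbed_closed (s : Gamma) :
  zmod_closed [pred c | c \in [set c | valuation c + s = s]].
Proof.
split; first by apply/mem_set; rewrite /= valuation0 add0r.
move=> c d /set_mem /= cs /set_mem /= ds; apply/mem_set => /=.
(* Extract the terms of [c] and [d] from [s]; next to them the term of [c + (- d)] is absorbed, and
   [s] takes both back. *)
rewrite -{1}ds -{1}cs [valuation d + _]addrCA !addrA -(valuationN d).
by rewrite valuationD valuationN -addrA ds cs.
Qed.

(** By idempotence [s] absorbs each of its own summands, hence the terms of the whole span of the
    [a i], and so those of the [b j] one after another. *)
Lemma Zspan_absorb (I J : finType) (a : I -> R) (b : J -> R) :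
  range b `<=` Zspan (range a) ->
  \sum_(j : J) valuation (b j) + \sum_(i : I) valuation (a i) =
  \sum_(i : I) valuation (a i).
Proof.
set s := \sum_(i : I) _ => sub.
have absorb : Zspan (range a) `<=` [set c | valuation c + s = s].
  apply: Zspan_min (absorbed_closed s) _ => _ [i _ <-] /=.
  by rewrite /s (bigD1 i) //= addrA Gamma_addxx.
apply: (big_ind (fun t => t + s = s)) => [|t u ts us|j _].
- exact: add0r.
- by rewrite -addrA us.
- by apply: absorb; apply: sub; exists j.
Qed.

End Valuation.

Theorem theorem8 (R : pzRingType) (I J : finType) (a : I -> R) (b : J -> R) :
  \pi_(universal_valuation_semiring R) (\sum_(i : I) bpoly_var (a i)) =
  \pi_(universal_valuation_semiring R) (\sum_(j : J) bpoly_var (b j))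
  <-> Zspan (range a) = Zspan (range b).
Proof.
split=> [/pi_same_Zspan|ab]; first by rewrite !bpoly_values_sum_var.
rewrite !(big_morph _ (@pi_GammaD R) (@pi_Gamma0 R)).
(* The right side is replaced by the sum of the two classes, which then collapses to the left side
   by the opposite absorption. *)
rewrite -[RHS](@Zspan_absorb _ _ _ b a) -?ab; last exact: sub_Zspan.
by rewrite addrC Zspan_absorb // ab; exact: sub_Zspan.
Qed.
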